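(* Let $\mathfrak{R}$ be a Rota--Baxter operator on a Clifford semigroup $(S,+)$, let $S_{\mathfrak{R}}=(S,+,\circ)$ be the dual weak brace associated to $\mathfrak{R}$, and let $r$ be the solution associated to $S_{\mathfrak{R}}$. Then $S_{\mathfrak{R}^{op}}=(S,+,\tilde\circ)$ and $S_{\mathfrak{R}}^{op}$ are isomorphic, and the opposite solution $r^{op}$ of $r$ is equivalent to the solution associated to $S_{\mathfrak{R}^{op}}$. In particular, $r^{op}$ is given by $$r^{op}(a,b)=\Big(\lambda_a(b)^{op},\ -\mathfrak{R}\big(\lambda_a(b)^{op}\big)-\lambda_a(b)^{op}+a+\lambda_a(b)^{op}+\mathfrak{R}\big(\lambda_a(b)^{op}\big)\Big),$$ where $\lambda_a(b)^{op}=a+\mathfrak{R}(a)+b-\mathfrak{R}(a)-a$, for all $a,b\in S$.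
   Context: A Clifford semigroup is an inverse semigroup with central idempotents. It is written additively (not assumed commutative): $-a$ is the inverse of $a$, $a-b:=a+(-b)$, and $a^0:=a-a=-a+a$. A Rota--Baxter operator on a Clifford semigroup $(S,+)$ is a map $\mathfrak{R}:S\to S$ such that, for all $a,b\in S$, $\mathfrak{R}(a)+\mathfrak{R}(b)=\mathfrak{R}(a+\mathfrak{R}(a)+b-\mathfrak{R}(a))$ and $a+\mathfrak{R}(a)^0=a$. The opposite operator $\mathfrak{R}^{op}:S\to S$, $\mathfrak{R}^{op}(a):=-a+\mathfrak{R}(-a)$, is again a Rota--Baxter operator on $(S,+)$. A weak brace is a triple $(S,+,\circ)$ such that $(S,+)$ and $(S,\circ)$ are inverse semigroups and, for all $a,b,c\in S$, $a\circ(b+c)=a\circ b-a+a\circ c$ and $a\circ a^-=-a+a$, where $-a$ and $a^-$ are the inverses of $a$ in $(S,+)$ and $(S,\circ)$ respectively. It is a dual weak brace if $(S,\circ)$ is a Clifford semigroup. For a Rota--Baxter operator $\mathfrak{R}$ on $(S,+)$, the dual weak brace associated to $\mathfrak{R}$ is $S_{\mathfrak{R}}:=(S,+,\circ)$ with $a\circ b:=a+\mathfrak{R}(a)+b-\mathfrak{R}(a)$; $S_{\mathfrak{R}^{op}}=(S,+,\tilde\circ)$ is the dual weak brace obtained in the same way from $\mathfrak{R}^{op}$, i.e. $a\,\tilde\circ\, b=a+\mathfrak{R}^{op}(a)+b-\mathfrak{R}^{op}(a)$. Isomorphisms of weak braces are bijections preserving both operations. The opposite of a weak brace $T=(S,+,\circ)$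 is the weak brace $T^{op}=(S,+^{op},\circ)$ with $a+^{op}b:=b+a$. A set-theoretic solution of the Yang--Baxter equation on $S$ (a solution, for short) is a map $r:S\times S\to S\times S$ with $(r\times\mathrm{id})(\mathrm{id}\times r)(r\times\mathrm{id})=(\mathrm{id}\times r)(r\times\mathrm{id})(\mathrm{id}\times r)$. The solution associated to a weak brace $(S,+,\circ)$ is $r(a,b)=(-a+a\circ b,\ (-a+a\circ b)^-\circ a\circ b)$. The opposite solution $r^{op}$ of $r$ is the solution associated to the opposite weak brace. Two solutions $r,s$ on $S$ are equivalent if there is a bijection $f:S\to S$ with $(f\times f)r=s(f\times f)$.
   Formalization: In the second component of r^op(a,b), the term after a is λ_a(b) = -a + a∘b instead of the printed λ_a(b)^op; as printed the formula fails for R = 0 on any non-abelian group. *)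

(* Defs.v *)
From mathcomp Require Import ssreflect ssrfun ssrbool.

Set Implicit Arguments.
Unset Strict Implicit.
Unset Printing Implicit Defensive.

(* Structures are parameterized by their carrier, because a weak brace carries
   two semigroup operations and several structures live on the same set.  The
   field inv is not extra data: it names the inverse whose existence and
   uniqueness define inverse semigroups. *)
Record inverseSemigroup (S : Type) := InverseSemigroup {
  op : S -> S -> S;
  inv : S -> S;
  opA : associative op;
  op_inv_op : forall a, op (op a (inv a)) a = a;
  inv_op_inv : forall a, op (op (inv a) a) (inv a) = inv a;
  inv_unique : forall a b, op (op a b) a = a -> op (op b a) b = b -> b = inv a
}.

Declare Scope isg_scope.
Delimit Scope isg_scope with isg.
Open Scope isg_scope.

Notation "a +_[ A ] b" := (op A a b)
  (at level 50, A at level 200, left associativity, format "a  +_[ A ]  b")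
  : isg_scope.
Notation "-_[ A ] a" := (inv A a)
  (at level 35, A at level 200, right associativity, format "-_[ A ]  a")
  : isg_scope.
Notation "a -_[ A ] b" := (op A a (inv A b))
  (at level 50, A at level 200, left associativity, format "a  -_[ A ]  b")
  : isg_scope.

Definition central_idempotents (S : Type) (A : inverseSemigroup S) : Prop :=
  forall e a : S, e +_[A] e = e -> e +_[A] a = a +_[A] e.

Record cliffordSemigroup (S : Type) := CliffordSemigroup {
  cs_isg :> inverseSemigroup S;
  cs_central : central_idempotents cs_isg
}.

(* For a weak brace T, a +_[mul T] b is the product a \circ b and -_[mul T] a is
   the inverse of a for \circ. *)
Record weakBrace (S : Type) := WeakBrace {
  add : inverseSemigroup S;
  mul : inverseSemigroup S;
  wb_distr : forall a b c : S,
    a +_[mul] (b +_[add] c) = (a +_[mul] b) -_[add] a +_[add] (a +_[mul] c);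
  wb_idem : forall a : S, a -_[mul] a = (-_[add] a) +_[add] a
}.

Record dualWeakBrace (S : Type) := DualWeakBrace {
  dwb_brace :> weakBrace S;
  dwb_clifford : central_idempotents (mul dwb_brace)
}.

Record rotaBaxter (S : Type) (A : cliffordSemigroup S) := RotaBaxter {
  rb_fun :> S -> S;
  rb_eq : forall a b : S,
    rb_fun a +_[A] rb_fun b = rb_fun (a +_[A] rb_fun a +_[A] b -_[A] rb_fun a);
  rb_idem : forall a : S, a +_[A] (rb_fun a -_[A] rb_fun a) = a
}.

Definition weakBrace_iso (S S' : Type) (T : weakBrace S) (T' : weakBrace S')
    (f : S -> S') : Prop :=
  [/\ bijective f,
      forall a b, f (a +_[add T] b) = f a +_[add T'] f b
    & forall a b, f (a +_[mul T] b) = f a +_[mul T'] f b].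

Definition weakBrace_isomorphic (S S' : Type)
    (T : weakBrace S) (T' : weakBrace S') : Prop :=
  exists f : S -> S', weakBrace_iso T T' f.

Section YangBaxter.
Variable S : Type.
Implicit Types (r s : S * S -> S * S).

(* r x id and id x r on S x S x S *)
Definition ybe_left r (x : S * S * S) : S * S * S := (r x.1, x.2).

Definition ybe_right r (x : S * S * S) : S * S * S :=
  let y := r (x.1.2, x.2) in (x.1.1, y.1, y.2).

Definition is_solution r : Prop := forall x : S * S * S,
  ybe_left r (ybe_right r (ybe_left r x)) =
  ybe_right r (ybe_left r (ybe_right r x)).

Record solution := Solution {
  sol_map :> S * S -> S * S;
  sol_ybe : is_solution sol_map
}.

Definition solution_equivalent (r s : solution) : Prop :=
  exists2 f : S -> S, bijective f &
    forall a b : S,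
      (f (r (a, b)).1, f (r (a, b)).2) = s (f a, f b).

End YangBaxter.

Section InverseSemigroupTheory.
Variables (S : Type) (A : inverseSemigroup S).
Local Notation "a + b" := (op A a b).
Local Notation "- a" := (inv A a).
Local Notation "a - b" := (op A a (inv A b)).
Let addA := opA A.

Lemma inv_inv a : - - a = a.
Proof. by apply/esym/inv_unique; [exact: inv_op_inv | exact: op_inv_op]. Qed.

Lemma idem_inv e : e + e = e -> - e = e.
Proof. by move=> ee; apply/esym/inv_unique; rewrite !ee. Qed.

Lemma idem_subr a : (a - a) + (a - a) = a - a.
Proof. by rewrite addA op_inv_op. Qed.

Lemma idem_subl a : (- a + a) + (- a + a) = - a + a.
Proof. by rewrite addA inv_op_inv. Qed.

Lemma idem_addI e f : e + e = e -> f + f = f -> (e + f) + (e + f) = e + f.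
Proof.
move=> ee ff; set x := - (e + f).
have h1 : (e + f) + x + (e + f) = e + f by exact: op_inv_op.
have h2 : x + (e + f) + x = x by exact: inv_op_inv.
have xE : f + x + e = x.
  apply: inv_unique.
    by rewrite !addA -(addA e f f) ff -(addA _ e e) ee -!addA addA addA
               -[RHS]h1 !addA.
  have -> : f + x + e + (e + f) + (f + x + e)
            = f + (x + ((e + e) + (f + f)) + x) + e by rewrite !addA.
  by rewrite ee ff h2.
have xx : x + x = x.
  rewrite -{1 2}xE -[RHS]xE -{3}h2.
  by rewrite !addA.
have -> : e + f = x by rewrite -(idem_inv xx) /x inv_inv.
exact: xx.
Qed.

Lemma idem_addC e f : e + e = e -> f + f = f -> e + f = f + e.
Proof.
move=> ee ff.
have efI := idem_addI ee ff; have feI := idem_addI ff ee.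
rewrite -[LHS](idem_inv efI); apply/esym/inv_unique.
  have -> : e + f + (f + e) + (e + f) = e + (f + f) + (e + e) + f.
    by rewrite !addA.
  by rewrite ff ee -addA.
have -> : f + e + (e + f) + (f + e) = f + (e + e) + (f + f) + e.
  by rewrite !addA.
by rewrite ff ee -addA.
Qed.

Lemma inv_op a b : - (a + b) = - b - a.
Proof.
have C : (b - b) + (- a + a) = (- a + a) + (b - b).
  by apply: idem_addC; [exact: idem_subr | exact: idem_subl].
apply/esym/inv_unique.
  have -> : a + b + (- b - a) + (a + b) = a + ((b - b) + (- a + a)) + b.
    by rewrite !addA.
  by rewrite C !addA op_inv_op -addA -addA (addA b) op_inv_op.
have -> : - b - a + (a + b) + (- b - a) = - b + ((- a + a) + (b - b)) - a.
  by rewrite !addA.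
by rewrite -C !addA inv_op_inv -addA -addA (addA (- a)) inv_op_inv.
Qed.

End InverseSemigroupTheory.

Section CliffordTheory.
Variables (S : Type) (A : cliffordSemigroup S).
Local Notation "a + b" := (op A a b).
Local Notation "- a" := (inv A a).
Local Notation "a - b" := (op A a (inv A b)).
Local Notation z a := (a - a).
Let addA := opA A.

Lemma clif_zC a x : z a + x = x + z a.
Proof. by apply: cs_central; exact: idem_subr. Qed.

Lemma clif_zN a : - a + a = z a.
Proof.
have C x : (- a + a) + x = x + (- a + a).
  by apply: cs_central; exact: idem_subl.
have h1 : - a + a + z a = z a by rewrite C -addA -C inv_op_inv.
have h2 : z a + (- a + a) = - a + a by rewrite clif_zC -addA -clif_zC op_inv_op.
by rewrite -h2 -C h1.
Qed.

Lemma clif_az a : a + z a = a.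
Proof. by rewrite -clif_zC op_inv_op. Qed.

Lemma clif_za a : z a + a = a.
Proof. exact: op_inv_op. Qed.

Lemma clif_zNN a : z (- a) = z a.
Proof. by rewrite inv_inv clif_zN. Qed.

Lemma clif_zD a b : z (a + b) = z a + z b.
Proof. by rewrite inv_op addA -(addA a b) -clif_zC -addA clif_zC. Qed.

Lemma clif_zz a : z (z a) = z a.
Proof. by rewrite (idem_inv (idem_subr A a)) idem_subr. Qed.

End CliffordTheory.

(* In a regular semigroup with central idempotents, inverses are unique. *)
Lemma idem_commute_unique (S : Type) (o : S -> S -> S) (i : S -> S) :
  associative o ->
  (forall a, o (o a (i a)) a = a) -> (forall a, o (o (i a) a) (i a) = i a) ->
  (forall e a, o e e = e -> o e a = o a e) ->
  forall a b, o (o a b) a = a -> o (o b a) b = b -> b = i a.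
Proof.
move=> oA o1 o2 oC a b ab ba; set c := i a.
have iba : o (o b a) (o b a) = o b a by rewrite oA ba.
have iac : o (o a c) (o a c) = o a c by rewrite oA o1.
have ica : o (o c a) (o c a) = o c a by rewrite oA o2.
have iab : o (o a b) (o a b) = o a b by rewrite oA ab.
have -> : b = o (o c a) b.
  transitivity (o (o (o b a) (o c a)) b).
    have -> : o (o b a) (o c a) = o b (o (o a c) a) by rewrite !oA.
    by rewrite o1 ba.
  by rewrite (oC _ _ iba) -oA ba.
transitivity (o c (o (o a c) (o a b))); first by rewrite !oA o2.
rewrite (oC _ _ iac); have -> : o c (o (o a b) (o a c)) = o c (o (o (o a b) a) c).
  by rewrite !oA.
by rewrite ab oA o2.
Qed.

Section WeakBraceTheory.
Variables (S : Type) (T : weakBrace S).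
Local Notation "a + b" := (op (add T) a b).
Local Notation "- a" := (inv (add T) a).
Local Notation "a - b" := (op (add T) a (inv (add T) b)).
Local Notation "a * b" := (op (mul T) a b).
Local Notation j := (inv (mul T)).
Let addA := opA (add T).
Let mulA := opA (mul T).

Definition lam (a b : S) : S := - a + a * b.

Definition rho (a b : S) : S := j (lam a b) * a * b.

Definition brace_map (x : S * S) : S * S := (lam x.1 x.2, rho x.1 x.2).

Lemma wb_mul_idem f : f * f = f -> f + f = f.
Proof. by move=> ff; rewrite -{1 2 3}ff -{2 4 6}(idem_inv ff) wb_idem idem_subl. Qed.

Lemma wb_add_idem f : f + f = f -> f * f = f.
Proof.
move=> ff; have h : f * j f = f by rewrite wb_idem (idem_inv ff) ff.
by rewrite -{1 2 3}h idem_subr.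
Qed.

Lemma wb_add_lam a b : a + lam a b = a * b.
Proof.
(* x := a * (b - b) satisfies x - a + x = x, whence x lies below a *)
rewrite /lam addA; set x := a * (b - b).
have h1 : x - a + x = x by rewrite /x -wb_distr idem_subr.
have nx : - x = - a + x - a.
  apply/esym/inv_unique; first by rewrite !addA h1 h1.
  have -> : - a + x - a + x + (- a + x - a) = - a + (x - a + x - a + x) - a.
    by rewrite !addA.
  by rewrite !h1.
have ax : a - a + x = x.
  have xE : x = a - x + a by rewrite -{1}(inv_inv (add T) x) {1}nx !inv_op !inv_inv addA.
  by rewrite {1}xE !addA op_inv_op -xE.
have bE : a * b = x - a + a * b by rewrite -wb_distr op_inv_op.
by rewrite bE !addA ax.
Qed.

Lemma wb_subr a b : a - a + a * b = a * b.
Proof. by rewrite -addA; exact: wb_add_lam. Qed.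

Lemma wb_zN a : a - a = - a + a.
Proof.
have h c : c - c + (- c + c) = - c + c by rewrite -wb_idem wb_subr.
have := h (- a); rewrite inv_inv (idem_addC (idem_subl _ a) (idem_subr _ a)).
by rewrite h.
Qed.

Lemma lamD a b c : lam a (b + c) = lam a b + lam a c.
Proof. by rewrite /lam wb_distr !addA. Qed.

Lemma lamN a b : lam a (- b) = - lam a b.
Proof. by apply: inv_unique; rewrite -!lamD ?op_inv_op ?inv_op_inv. Qed.

Lemma lamM a b c : lam (a * b) c = lam a (lam b c).
Proof.
rewrite [lam b c]/lam lamD lamN /lam inv_op inv_inv -addA (addA a).
by rewrite wb_subr mulA.
Qed.

Lemma wb_idem_mul e f : e + e = e -> f + f = f -> e * f = e + f.
Proof.
move=> ee ff; have ee' := wb_add_idem ee; have ff' := wb_add_idem ff.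
set g := e + f.
have gg : g + g = g by exact: idem_addI.
have eg : e + g = g by rewrite /g addA ee.
have egm : e * g = e * f.
  by rewrite /g wb_distr ee' wb_subr.
have ge : g * e = g.
  have h : g * (e + g) = g * e.
    have ige : g * e + g * e = g * e.
      by apply: wb_mul_idem; apply: idem_addI; exact: wb_add_idem.
    rewrite wb_distr (wb_add_idem gg) (idem_inv gg) -addA gg.
    by rewrite (idem_addC ige gg) -[RHS]wb_subr (idem_inv gg) gg.
  by rewrite -h eg; apply: wb_add_idem.
by rewrite -egm -[RHS]ge; apply: (idem_addC ee' (wb_add_idem gg)).
Qed.

Lemma lam_idem e x : e + e = e -> lam e x = e * x.
Proof. by move=> ee; rewrite -(wb_add_lam e x) /lam (idem_inv ee) !addA !ee. Qed.

Lemma lam_mul_rho a b : lam a b * rho a b = a * b.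
Proof.
rewrite /rho !mulA wb_idem.
set l := lam a b; set f := a * b * j (a * b).
have ff : f + f = f by apply: wb_mul_idem; exact: idem_subr.
have il : (- l + l) + (- l + l) = - l + l by exact: idem_subl.
have h : (- l + l) * f = f.
  rewrite wb_idem_mul // (idem_addC il ff) /f wb_idem -addA.
  by rewrite -{2 4}(wb_add_lam a b) -/l -(addA a) (addA l) op_inv_op.
by rewrite -(mulA _ a b) -(op_inv_op (mul T) (a * b)) -/f mulA h.
Qed.

Lemma lam_rho a b c : lam (lam a b) (lam (rho a b) c) = lam a (lam b c).
Proof. by rewrite -!lamM lam_mul_rho. Qed.

Lemma lam_mul a b c : lam a b * lam (rho a b) c = lam a (b * c).
Proof. by rewrite -wb_add_lam lam_rho -lamD wb_add_lam. Qed.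

Lemma rho_mul a b c : rho (rho a b) c = rho a (b * c).
Proof. by rewrite [RHS]/rho -lam_mul inv_op /rho !mulA. Qed.

Lemma rho_lam a b c :
  rho (lam a b) (lam (rho a b) c) = lam (rho a (lam b c)) (rho b c).
Proof.
rewrite {1}/rho lam_rho -mulA lam_mul -(lam_mul_rho b c) -lam_mul mulA.
set y := lam a (lam b c); set w := rho b c.
have ee : (j y * y) * (j y * y) = j y * y by exact: idem_subl.
rewrite -lam_idem; last exact: wb_mul_idem.
by rewrite -lamM; congr (lam _ _); rewrite /rho -/y !mulA inv_op_inv.
Qed.

Lemma brace_map_solution : is_solution brace_map.
Proof.
move=> [[a b] c]; rewrite /ybe_left /ybe_right /brace_map.
cbn [fst snd].
by rewrite lam_rho rho_lam !rho_mul lam_mul_rho.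
Qed.

Definition brace_solution : solution S := Solution brace_map_solution.

Definition opposite_isg (A : inverseSemigroup S) : inverseSemigroup S.
Proof.
refine (@InverseSemigroup S (fun a b => op A b a) (inv A) _ _ _ _).
- by move=> a b c; rewrite opA.
- by move=> a; rewrite opA op_inv_op.
- by move=> a; rewrite opA inv_op_inv.
- by move=> a b ab ba; apply: inv_unique; rewrite -opA.
Defined.

Definition opposite_brace : weakBrace S.
Proof.
refine (@WeakBrace S (opposite_isg (add T)) (mul T) _ _).
- by move=> a b c /=; rewrite wb_distr addA.
- by move=> a /=; rewrite wb_idem wb_zN.
Defined.

End WeakBraceTheory.

(* The opposite of the solution brace_solution T. *)
Definition opposite_solution (S : Type) (T : weakBrace S) : solution S :=
  brace_solution (opposite_brace T).

Section RotaBaxterTheory.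
Variables (S : Type) (A : cliffordSemigroup S) (R : rotaBaxter A).
Local Notation "a + b" := (op A a b).
Local Notation "- a" := (inv A a).
Local Notation "a - b" := (op A a (inv A b)).
Local Notation z a := (a - a).
Let addA := opA A.

Definition rb_circ (a b : S) : S := a + R a + b - R a.

Definition rb_circ_inv (a : S) : S := - R a - a + R a.

Lemma rb_circE a b : R (rb_circ a b) = R a + R b.
Proof. by rewrite rb_eq. Qed.

Lemma rb_za a : z (R a) + a = a.
Proof. by rewrite clif_zC rb_idem. Qed.

Lemma rb_zz a : z a + z (R a) = z a.
Proof. by rewrite -{1}(clif_zz A (R a)) -clif_zD rb_idem. Qed.

Lemma rb_circA : associative rb_circ.
Proof.
move=> a b c; rewrite {3}/rb_circ rb_circE inv_op !addA.
rewrite /rb_circ !addA; congr (_ + _ + _ + _ + _).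
by rewrite -(addA _ (- R a)) clif_zN -[RHS]clif_zC !addA rb_za.
Qed.

Lemma rb_circ_idem_self e : e + e = e -> rb_circ e e = e.
Proof.
move=> ee; rewrite /rb_circ -(addA e) -(cs_central (R e) ee) addA ee -addA.
exact: rb_idem.
Qed.

Lemma rb_idemR e : e + e = e -> R e + R e = R e.
Proof. by move=> ee; rewrite -rb_circE rb_circ_idem_self. Qed.

Lemma rb_circ_idem e x : e + e = e -> rb_circ e x = e + x.
Proof.
move=> ee; rewrite /rb_circ -(addA e) (cs_central x (rb_idemR ee)) addA -addA.
by rewrite -clif_zC addA rb_za.
Qed.

Lemma rb_circ_idemr e x : e + e = e -> rb_circ x e = e + x.
Proof.
move=> ee; rewrite /rb_circ -(cs_central _ ee) addA -!addA.
by rewrite rb_idem.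
Qed.

Lemma rb_zR_inv a : z (rb_circ_inv a) = z a.
Proof.
by rewrite /rb_circ_inv !clif_zD !clif_zNN -clif_zC addA idem_subr clif_zC rb_zz.
Qed.

Lemma rb_absorb a x : a + x + z (R a) = a + x.
Proof. by rewrite -clif_zC addA rb_za. Qed.

Lemma rb_circV a : rb_circ a (rb_circ_inv a) = z a.
Proof.
rewrite /rb_circ /rb_circ_inv !addA -(addA a) rb_idem -addA.
exact: rb_absorb.
Qed.

Lemma rb_Rz a : R (z a) = z (R a).
Proof.
set f := R (z a); have ff : f + f = f by apply/rb_idemR/idem_subr.
have h1 : f + R a = R a.
  by rewrite /f -rb_circE rb_circ_idem ?clif_za //; apply: idem_subr.
have h2 : R a + R (rb_circ_inv a) = f by rewrite -rb_circE rb_circV.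
have h3 : z (R a) + f = f by rewrite -h2 addA clif_za.
by rewrite -h3 clif_zC addA h1.
Qed.

Lemma rb_R_inv a : R (rb_circ_inv a) = - R a.
Proof.
set b := rb_circ_inv a.
have h1 : R a + R b = z (R a) by rewrite -rb_circE rb_circV rb_Rz.
have h2 : z (R b) = z (R a) by rewrite -!rb_Rz rb_zR_inv.
by rewrite -(clif_za A (R b)) h2 -clif_zN -addA h1 -{1}(clif_zNN A) clif_az.
Qed.

Lemma rb_circVl a : rb_circ (rb_circ_inv a) a = z a.
Proof.
rewrite /rb_circ rb_R_inv inv_inv /rb_circ_inv.
have -> : - R a - a + R a - R a + a + R a = - R a + (- a + (z (R a) + a)) + R a.
  by rewrite !addA.
by rewrite rb_za clif_zN -clif_zC -addA clif_zN rb_zz.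
Qed.

Lemma rb_circ_op_inv a : rb_circ (rb_circ a (rb_circ_inv a)) a = a.
Proof. by rewrite rb_circV rb_circ_idem ?clif_za //; apply: idem_subr. Qed.

Lemma rb_circ_inv_op a :
  rb_circ (rb_circ (rb_circ_inv a) a) (rb_circ_inv a) = rb_circ_inv a.
Proof.
rewrite rb_circVl rb_circ_idem -1?(rb_zR_inv a) ?clif_za //; exact: idem_subr.
Qed.

Lemma rb_circ_idemE e : rb_circ e e = e -> e + e = e.
Proof.
move=> ee; have RR : R e + R e = R e by rewrite -rb_circE ee.
have := rb_idem R e; rewrite (idem_inv RR) RR => eR.
by move: ee; rewrite /rb_circ (idem_inv RR) eR -addA eR.
Qed.

Lemma rb_circ_central e a : rb_circ e e = e -> rb_circ e a = rb_circ a e.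
Proof.
by move=> /rb_circ_idemE ee; rewrite rb_circ_idem // rb_circ_idemr.
Qed.

Definition rb_isg : inverseSemigroup S :=
  InverseSemigroup rb_circA rb_circ_op_inv rb_circ_inv_op
    (idem_commute_unique rb_circA rb_circ_op_inv rb_circ_inv_op
       rb_circ_central).

Lemma rb_circ_distr a b c :
  rb_circ a (b + c) = rb_circ a b - a + rb_circ a c.
Proof.
rewrite /rb_circ !addA.
have -> : a + R a + b - R a - a + a + R a + c - R a
          = a + (R a + b - R a + (- a + a)) + R a + c - R a by rewrite !addA.
rewrite clif_zN -clif_zC (addA a) clif_az !addA; congr (_ + _ - _).
by rewrite -(addA _ _ (R a)) clif_zN -(addA a (R a) b) rb_absorb.
Qed.

Lemma rb_circ_zN a : rb_circ a (rb_circ_inv a) = - a + a.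
Proof. by rewrite rb_circV clif_zN. Qed.

Definition rb_brace : dualWeakBrace S :=
  @DualWeakBrace S
    (@WeakBrace S A rb_isg rb_circ_distr rb_circ_zN) rb_circ_central.

Definition rb_opp_fun (a : S) : S := - a + R (- a).

Lemma rb_opp_circ a b :
  - (a + rb_opp_fun a + b - rb_opp_fun a) = rb_circ (- a) (- b).
Proof.
rewrite /rb_opp_fun /rb_circ !inv_op !inv_inv !addA.
have -> x : x + a - a = z a + x by rewrite -addA clif_zC.
by rewrite !addA -(clif_zN A a) inv_op_inv.
Qed.

Lemma rb_opp_eq a b :
  rb_opp_fun a + rb_opp_fun b =
  rb_opp_fun (a + rb_opp_fun a + b - rb_opp_fun a).
Proof.
rewrite [RHS]/rb_opp_fun rb_opp_circ rb_circE /rb_opp_fun /rb_circ !addA.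
congr (_ + _).
by rewrite -(addA _ _ (R (- a))) clif_zN -(addA (- a) _ (- b)) rb_absorb.
Qed.

Lemma rb_opp_idem a : a + (rb_opp_fun a - rb_opp_fun a) = a.
Proof.
have h : z (rb_opp_fun a) = z a by rewrite clif_zD rb_zz clif_zNN.
by rewrite h clif_az.
Qed.

Definition rb_opp : rotaBaxter A := RotaBaxter rb_opp_eq rb_opp_idem.

End RotaBaxterTheory.

(* Main.v *)
(* Negation a |-> -a is an anti-automorphism of (S, +) and turns the operation
   of S_{R^op} into that of S_R, hence is an isomorphism from S_{R^op} onto
   S_R^op; solutions are transported along isomorphisms.  The formula for r^op
   comes from the explicit inverse a^- = -R(a) - a + R(a) and R(a^-) = -R(a). *)
Require Import Defs.
From mathcomp Require Import ssreflect ssrfun ssrbool.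

Lemma iso_morph_inv (S S' : Type) (A : inverseSemigroup S)
    (B : inverseSemigroup S') (f : S -> S') :
  (forall a b, f (a +_[A] b) = f a +_[B] f b) ->
  forall a, f (-_[A] a) = -_[B] f a.
Proof.
by move=> fD a; apply: inv_unique; rewrite -!fD ?op_inv_op ?inv_op_inv.
Qed.

(** [lam] and [rho] are words in the two operations and their inverses, and a morphism preserves all
    of these. *)
Lemma weakBrace_iso_solution (S : Type) (T T' : weakBrace S) (f : S -> S) :
  weakBrace_iso T T' f ->
  forall a b, (f (brace_solution T (a, b)).1, f (brace_solution T (a, b)).2)
              = brace_solution T' (f a, f b).
Proof.
move=> [_ fD fM] a b.
have flam : f (lam T a b) = lam T' (f a) (f b).
  by rewrite /lam fD (iso_morph_inv _ _ _ _ _ fD) fM.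
rewrite /= /brace_map /=; congr pair => //.
by rewrite /rho !fM (iso_morph_inv _ _ _ _ _ fM) flam.
Qed.

Lemma weakBrace_iso_sym (S S' : Type) (T : weakBrace S) (T' : weakBrace S')
    (f : S -> S') (g : S' -> S) :
  cancel f g -> cancel g f -> weakBrace_iso T T' f -> weakBrace_iso T' T g.
Proof.
move=> fK gK [_ fD fM]; split; first by exists f.
- by move=> a b; rewrite -{1}(gK a) -{1}(gK b) -fD fK.
- by move=> a b; rewrite -{1}(gK a) -{1}(gK b) -fM fK.
Qed.

Lemma rb_opp_iso (S : Type) (A : cliffordSemigroup S) (R : rotaBaxter A) :
  weakBrace_iso (rb_brace (rb_opp R)) (opposite_brace (rb_brace R)) (inv A).
Proof.
split; first by exists (inv A); exact: inv_inv.
- by move=> a b; exact: inv_op.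
- by move=> a b; exact: rb_opp_circ.
Qed.

Lemma rb_circ_invE (S : Type) (A : cliffordSemigroup S) (R : rotaBaxter A)
    (a b : S) :
  rb_circ R (rb_circ_inv R a) b = (-_[A] R a) -_[A] a +_[A] b +_[A] R a.
Proof.
rewrite /rb_circ rb_R_inv inv_inv {1}/rb_circ_inv; congr (_ +_[A] _ +_[A] _).
(* With [R (a^-) = - R a] the product leaves [R a - R a] after [- a]; [rb_zz] lets [- a] absorb
   it. *)
have aR : -_[A] a +_[A] (R a -_[A] R a) = -_[A] a.
  by rewrite -[X in X +_[A] _](clif_az A) clif_zNN -opA rb_zz -(clif_zNN A)
             clif_az.
by rewrite -(opA A _ (R a)) -(opA A _ (-_[A] a)) aR.
Qed.

Theorem proposition18 (S : Type) (A : cliffordSemigroup S) (R : rotaBaxter A) :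
  weakBrace_isomorphic (rb_brace (rb_opp R)) (opposite_brace (rb_brace R)) /\
  solution_equivalent (opposite_solution (rb_brace R))
                      (brace_solution (rb_brace (rb_opp R))) /\
  (forall a b : S,
     let l := lam (rb_brace R) a b in
     let lop := a +_[A] R a +_[A] b -_[A] R a -_[A] a in
     opposite_solution (rb_brace R) (a, b) =
     (lop,
      (-_[A] R lop) -_[A] lop +_[A] a +_[A] l +_[A] R lop)).
Proof.
split; first by exists (inv A); exact: rb_opp_iso.
split.
  exists (inv A); first by exists (inv A); exact: inv_inv.
  apply: weakBrace_iso_solution.
  (* The equivalence starts from r^op, so the isomorphism is inverted; negation is its own
     inverse. *)
  by apply: weakBrace_iso_sym (rb_opp_iso _ _ R); exact: inv_inv.
move=> a b l lop.
(* The middle of the second component is [a + l], i.e. the product of [a] and [b] in S_R; [a + lop]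
   differs from it in general. *)
have al : a +_[A] l = rb_circ R a b by exact: (wb_add_lam (rb_brace R)).
(* In the opposite brace, [lam a b] unfolds to [rb_circ R a b - a], which is [lop]; the product is
   unchanged. *)
have rhoE : rho (opposite_brace (rb_brace R)) a b
            = rb_circ R (rb_circ_inv R lop) (rb_circ R a b).
  by rewrite rb_circA.
rewrite -(opA A _ a) al -rb_circ_invE -rhoE.
by [].
Qed.
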